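(* Let $\alpha^*=\arg\min_{\alpha\in\Theta}E\{L(Y,X,\alpha)\}$, let $Z\in\mathbb{R}^d$ be a deterministic function of $X$ whose first element is $1$, and let $\rho\in[0,+\infty)$. Suppose: (C2) $E[\sup_{\alpha\in\Theta}\{L(Y,X,\alpha)\}^2]<\infty$, $S(\alpha)$ is continuously differentiable, $E\{\sup_{\alpha\in\Theta}\|S(\alpha)\|_2^2\}<\infty$ and $E\{\sup_{\alpha\in\Theta}\|\nabla_{\mathrm{Vec}(\alpha)}S(\alpha)\|\}<\infty$, where $\|\cdot\|$ is the spectral norm; (C4) $\alpha^*$ is an interior point of the compact set $\Theta\subset\mathbb{R}^{p\times q}$, and $\tilde{\mathbf H}=E\{\nabla_{\mathrm{Vec}(\alpha)}S(\alpha)|_{\alpha=\alpha^*}\}$ is nonsingular; (C5) $Z$ is bounded almost surely and $\Sigma_Z=E(ZZ^{\top})$ is nonsingular. Put $A=\Sigma_Z^{-1}E\{ZS(\alpha^* )^{\top}\}$, $U=S(\alpha^* )-A^{\top}Z$, $\Sigma=E\{S(\alpha^* )S(\alpha^* )^{\top}\}$ and $\Sigma_\rho=E(WW^{\top})+\rho\,E(VV^{\top})$ with $W=S(\alpha^* )-\frac{1}{1+\rho}A^{\top}Z$ and $V=\frac{1}{1+\rho}A^{\top}Z$. Then $$\Sigma=E(UU^{\top})+E\{(A^{\top}Z)(A^{\top}Z)^{\top}\},\qquad \Sigma_\rho=E(UU^{\top})+\frac{\rho}{1+\rho}E\{(A^{\top}Z)(A^{\top}Z)^{\top}\},$$ and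 hence $\Sigma_\rho\le\Sigma$ in the positive semidefinite order. Consequently, for every $\tau\in(0,1)$, the asymptotic covariance $\tilde b(\tau)^{\top}\tilde{\mathbf H}^{-1}\Sigma_\rho\tilde{\mathbf H}^{-1}\tilde b(\tau)$ of the semi-supervised estimator is no larger, in the positive semidefinite order, than the asymptotic covariance $\tilde b(\tau)^{\top}\tilde{\mathbf H}^{-1}\Sigma\,\tilde{\mathbf H}^{-1}\tilde b(\tau)$ of the supervised estimator, where $\tilde b(\tau)=\big(\int_0^1 b(t)J_\tau(t)\,dt\big)\otimes I_p$.
   Context: $Y$ is real-valued, $X$ takes values in $\mathbb{R}^p$ (column vector), $b(t)=(b_1(t),\ldots,b_q(t))^{\top}$ is a vector of $q$ known functions of $t\in(0,1)$, and $\Theta$ is the parameter set of $p\times q$ matrices $\alpha$. The quantile check function is $\rho_t(r)=t r-r\,\mathrm I(r<0)$ (not to be confused with the constant $\rho$) and the loss is $L(Y,X,\alpha)=\int_0^1\rho_t(Y-X^{\top}\alpha b(t))\,dt$. $\mathrm{Vec}(\alpha)$ stacks the columns of $\alpha$; $\otimes$ is the Kronecker product; $I_p$ is the $p\times p$ identity. For a single observation $(Y,X)$, the score is $S(\alpha)=\nabla_{\mathrm{Vec}(\alpha)}L(Y,X,\alpha)=\int_0^1 \{b(t)\otimes X\}\,[\mathrm I(Y<\{b(t)\otimes X\}^{\top}\mathrm{Vec}(\alpha))-t]\,dt$. For $\tau\in(0,1)$, $J_\tau(t)=\partial H_\tau(t)/\partial t$, where $H_\tau(t)=1-(1-t)^{s(\tau)}$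 if $0<\tau\le1/2$ and $H_\tau(t)=t^{r(\tau)}$ if $1/2\le\tau<1$, $t\in[0,1]$, with $r(\tau)=s(1-\tau)=\log(1/2)/\log(\tau)$. The constant $\rho$ is the limit of $n/N$, with $n$ labeled and $N$ unlabeled observations. The supervised estimator of $\alpha^*$ minimizes $\sum_{i=1}^nL(Y_i,X_i,\alpha)$; the semi-supervised one minimizes $\sum_{i=1}^nL(Y_i,X_i,\alpha)+\sum_{i=n+1}^{n+N}Z_i^{\top}\big(\frac1n\sum_{j=1}^nZ_jZ_j^{\top}\big)^{-1}\frac1n\sum_{j=1}^nZ_jL(Y_j,X_j,\alpha)$; the corresponding estimators of order-$\tau$ extremile coefficients are obtained by multiplying by $\int_0^1b(t)J_\tau(t)\,dt$. *)

(* Defs.v *)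
From HB Require Import structures.
From mathcomp Require Import all_boot all_order all_algebra.
From mathcomp Require Import all_classical all_reals all_analysis.
From mathcomp Require Import measurable_realfun.
From mathcomp Require Import ring lra.
From mathcomp.real_closed Require Export mxtens.

Set Implicit Arguments.
Unset Strict Implicit.
Unset Printing Implicit Defensive.

Import Order.TTheory GRing.Theory Num.Theory.
Import numFieldTopology.Exports numFieldNormedType.Exports.

Local Open Scope classical_set_scope.
Local Open Scope ring_scope.

Section vectorization.
Context {R : realType} {p q : nat}.

(* Column j of alpha occupies the positions j * p, ..., j * p + p - 1, the
   layout of the Kronecker product of a q-vector with a p-vector ([tensmx]). *)
Definition vec (alpha : 'M[R]_(p, q)) : 'cV[R]_(q * p) :=
  \col_k alpha (mxtens_unindex k).2 (mxtens_unindex k).1.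

(* vec (vec_dir k) is the k-th vector of the canonical basis. *)
Definition vec_dir (k : 'I_(q * p)) : 'M[R]_(p, q) :=
  delta_mx (mxtens_unindex k).2 (mxtens_unindex k).1.

Definition grad_vec (f : 'M[R]_(p, q) -> R) (alpha : 'M[R]_(p, q)) :
    'cV[R]_(q * p) :=
  \col_k 'D_(vec_dir k) f alpha.

(* Entry (k, l) is the partial derivative of the k-th component of f with
   respect to the l-th coordinate of vec alpha. *)
Definition jac_vec {m : nat} (f : 'M[R]_(p, q) -> 'cV[R]_m)
    (alpha : 'M[R]_(p, q)) : 'M[R]_(m, q * p) :=
  \matrix_(k, l) grad_vec (fun a => f a k 0) alpha l 0.

Definition continuously_differentiable_on {m : nat} (D : set 'M[R]_(p, q))
    (f : 'M[R]_(p, q) -> 'cV[R]_m) : Prop :=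
  (forall alpha, D alpha -> differentiable f alpha) /\
  {within D, continuous (jac_vec f)}.

Definition kron (b : 'cV[R]_q) (x : 'cV[R]_p) : 'cV[R]_(q * p) := b *t x.

Lemma kronE b x k :
  kron b x k 0 = b (mxtens_unindex k).1 0 * x (mxtens_unindex k).2 0.
Proof. by rewrite mxE; congr (b _ _ * x _ _); apply: val_inj. Qed.

Lemma kron_vec b x alpha :
  ((kron b x)^T *m vec alpha) 0 0 = (x^T *m alpha *m b) 0 0.
Proof.
rewrite mxE (reindex (@mxtens_index q p)) /=; last first.
  by exists (@mxtens_unindex q p) => i _; rewrite (mxtens_indexK, mxtens_unindexK).
under eq_bigr do rewrite mxE kronE mxE mxtens_indexK/=.
rewrite -(pair_bigA _ (fun j i => b j 0 * x i 0 * alpha i j)) /= mxE.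
apply: eq_bigr => j _; rewrite mxE mulr_suml.
by apply: eq_bigr => i _; rewrite mxE -mulrA mulrC.
Qed.

Lemma vec_vec_dir k : vec (vec_dir k) = delta_mx k 0.
Proof.
apply/colP => l; rewrite !mxE eqxx andbT -(can_eq (@mxtens_unindexK q p)).
by case: (mxtens_unindex l) => a c; case: (mxtens_unindex k) => a' c';
  rewrite xpair_eqE andbC.
Qed.

End vectorization.

Section matrices.
Context {R : realType}.

Definition l2norm {n : nat} (v : 'cV[R]_n) : R :=
  Num.sqrt (\sum_i v i 0 ^+ 2).

Definition spectral_norm {m n : nat} (M : 'M[R]_(m, n)) : R :=
  sup [set l2norm (M *m v) | v in [set v : 'cV[R]_n | l2norm v <= 1]].

Definition loewner_le {n : nat} (A B : 'M[R]_n) : Prop :=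
  (B - A)^T = B - A /\
  forall v : 'cV[R]_n, 0 <= (v^T *m (B - A) *m v) 0 0.

(* Entrywise; [fine] only matters for non-integrable entries. *)
Definition Emx {d : measure_display} {T : measurableType d}
    (P : probability T R) {m n : nat} (M : T -> 'M[R]_(m, n)) : 'M[R]_(m, n) :=
  \matrix_(i, j) fine 'E_P[fun w => M w i j].

End matrices.

Section extremile_regression.
Context {R : realType} {p q : nat}.
Local Notation mu := (@lebesgue_measure R).
Implicit Types (b : R -> 'cV[R]_q) (y t r tau : R) (x : 'cV[R]_p).

Definition check_fun t r : R := t * r - r * (r < 0)%R%:R.

Definition loss b y x (alpha : 'M[R]_(p, q)) : R :=
  \int[mu]_(t in `]0, 1[) check_fun t (y - (x^T *m alpha *m b t) 0 0).

(* By [grad_loss] below, this is the gradient of the loss wherever the partial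
   derivatives of the loss exist. *)
Definition score b y x (alpha : 'M[R]_(p, q)) : 'cV[R]_(q * p) :=
  \col_k \int[mu]_(t in `]0, 1[)
    (kron (b t) x k 0 *
     ((y < ((kron (b t) x)^T *m vec alpha) 0 0)%R%:R - t)).

(* The score is always a subgradient of the loss, hence it is the gradient
   wherever the loss has partial derivatives. *)
Lemma check_fun_subgradient t r s : 0 < t < 1 ->
  check_fun t r + (t - (r < 0)%R%:R) * (s - r) <= check_fun t s.
Proof.
move=> /andP[t0 t1]; rewrite /check_fun.
by case: (ltP r 0) => r0; case: (ltP s 0) => s0 /=; nra.
Qed.

Let measurable_I01 : measurable (`]0, 1[ : set R) := measurable_itv _.

Section gradient.
Context (b : R -> 'cV[R]_q)
  (ib : forall j, mu.-integrable `]0, 1[ (fun t => (b t j 0)%:E)).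

Lemma integrable_bilinear x (a : 'M[R]_(p, q)) :
  mu.-integrable `]0, 1[ (fun t => ((x^T *m a *m b t) 0 0)%:E).
Proof.
rewrite (_ : (fun _ => _) = (fun t : R =>
    \sum_(j < q) (((x^T *m a) 0 j)%:E * (b t j 0)%:E)%E)%E); last first.
  by apply/funext => t; rewrite mxE -sumEFin.
by apply: integrable_sum => // j _; exact: integrableZl.
Qed.

Lemma integrable_affine y x (a : 'M[R]_(p, q)) :
  mu.-integrable `]0, 1[ (fun t => (y - (x^T *m a *m b t) 0 0)%:E).
Proof.
apply: (@eq_integrable _ _ _ mu _ measurable_I01
  (cst y%:E \- (fun t => ((x^T *m a *m b t) 0 0)%:E))%E) => //.
apply: integrableB => //; last exact: integrable_bilinear.
apply: (@measurable_bounded_integrable _ _ _ mu (cst y)) => //.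
  by rewrite /= lebesgue_measure_itv /= lte_fin ltr01 oppr0 adde0 ltry.
exact: bounded_cst.
Qed.

Lemma loss_integrable y x (a : 'M[R]_(p, q)) :
  mu.-integrable `]0, 1[
    (fun t => (check_fun t (y - (x^T *m a *m b t) 0 0))%:E).
Proof.
have := integrable_affine y x a.
set f : R -> R := fun t => y - (x^T *m a *m b t) 0 0 => fi.
have mf : measurable_fun (`]0, 1[ : set R) f by apply/measurable_EFinP; case/integrableP: fi.
apply: (le_integrable _ _ _ fi) => //.
  apply/measurable_EFinP; rewrite /check_fun; apply: measurable_funB.
    exact: measurable_funM.
  apply: measurable_funM => //.
  rewrite (_ : (fun _ => _) = fun t => if f t < 0 then 1 else 0 : R); last first.
    by apply/funext => t; case: ifP.
  by apply: measurable_fun_if => //; exact: measurable_fun_ltr.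
move=> t /=; rewrite in_itv /= => /andP[t0 t1]; rewrite lee_fin.
rewrite /check_fun -/(f t); move: (f t) => r; have [r0|r0] /= := ltP r 0.
  by rewrite (ltr0_norm r0) ler_norml; apply/andP; split; nra.
by rewrite (ger0_norm r0) ler_norml; apply/andP; split; nra.
Qed.

Lemma score_integrable y x (a : 'M[R]_(p, q)) k :
  mu.-integrable `]0, 1[
    (fun t => (kron (b t) x k 0 *
     ((y < ((kron (b t) x)^T *m vec a) 0 0)%R%:R - t))%:E).
Proof.
have ki : mu.-integrable `]0, 1[ (fun t => (kron (b t) x k 0)%:E).
  rewrite (_ : (fun _ => _) = (fun t : R =>
    (x (mxtens_unindex k).2 0)%:E * (b t (mxtens_unindex k).1 0)%:E)%E).
    exact: integrableZl.
  by apply/funext => t; rewrite kronE mulrC.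
have fi := integrable_affine y x a.
apply: (le_integrable _ _ _ ki) => //.
  apply/measurable_EFinP; apply: measurable_funM.
    by apply/measurable_EFinP; case/integrableP: ki.
  apply: measurable_funB => //.
  rewrite (_ : (fun _ => _) =
      fun t => if y - (x^T *m a *m b t) 0 0 < 0 then 1 else 0 : R); last first.
    by apply/funext => t; rewrite kron_vec subr_lt0; case: ifP.
  apply: measurable_fun_if => //; apply: measurable_fun_ltr => //.
  by apply/measurable_EFinP; case/integrableP: fi.
move=> t /=; rewrite in_itv /= => /andP[t0 t1]; rewrite lee_fin normrM.
rewrite ler_piMr// ler_norml.
by case: (y < _) => /=; apply/andP; split; lra.
Qed.

Lemma score_subgradient y x (a : 'M[R]_(p, q)) k h :
  loss b y x a + h * score b y x a k 0 <= loss b y x (h *: vec_dir k + a).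
Proof.
have Li := loss_integrable y x.
have Si := score_integrable y x a k.
have hSi := @integrableZl _ _ _ mu _ measurable_I01 h _ Si.
rewrite mxE -RintegralZl; [|exact: measurable_I01|exact: Si].
rewrite -RintegralD; [|exact: measurable_I01|exact: Li|exact: hSi].
apply: le_Rintegral; [exact: measurable_I01|exact: integrableD (Li a) hSi|exact: Li|].
move=> t /=; rewrite in_itv /= => t01.
set r := y - (x^T *m a *m b t) 0 0.
set s := y - (x^T *m (h *: vec_dir k + a) *m b t) 0 0.
apply: le_trans (check_fun_subgradient r s t01).
have kE : kron (b t) x k 0 = (x^T *m vec_dir k *m b t) 0 0.
  by rewrite -kron_vec vec_vec_dir -colE !mxE.
have -> : s = r - h * kron (b t) x k 0.
  rewrite /s /r kE mulmxDr mulmxDl -scalemxAr -scalemxAl.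
  by move: (x^T *m vec_dir k *m b t) (x^T *m a *m b t) => u v; rewrite !mxE; ring.
rewrite lerD2l kron_vec -subr_lt0 -/r.
by rewrite le_eqVlt; apply/orP; left; apply/eqP; ring.
Qed.

Lemma grad_loss y x (a : 'M[R]_(p, q)) :
  (forall k, derivable (loss b y x) a (vec_dir k)) ->
  grad_vec (loss b y x) a = score b y x a.
Proof.
move=> da; apply/colP => k; rewrite mxE; apply/eqP; rewrite eq_le.
have D : h^-1 * (loss b y x (h *: vec_dir k + a) - loss b y x a) @[h --> 0^']
    --> 'D_(vec_dir k) (loss b y x) a by exact: da.
apply/andP; split.
- apply: (cvgr_to_le (cvg_dnbhs_at_left D)); near=> h.
  have h0 : h < 0 by near: h; exact: nbhs_left_lt.
  by rewrite mulrC ler_ndivrMr// mulrC lerBrDl; exact: score_subgradient.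
- apply: (cvgr_to_ge (cvg_dnbhs_at_right D)); near=> h.
  have h0 : 0 < h by near: h; exact: nbhs_right_gt.
  by rewrite mulrC ler_pdivlMr// mulrC lerBrDl; exact: score_subgradient.
Unshelve. all: by end_near. Qed.

End gradient.

Definition r_exp tau : R := ln (1 / 2) / ln tau.

Definition s_exp tau : R := r_exp (1 - tau).

(* The two branches agree at tau = 1 / 2. *)
Definition H_fun tau t : R :=
  if tau <= 1 / 2 then 1 - (1 - t) `^ s_exp tau else t `^ r_exp tau.

Definition J_fun tau : R -> R := derive1 (H_fun tau).

(* A qp x p matrix, up to the equality 1 * p = p. *)
Definition b_tilde b tau : 'M[R]_(q * p, 1 * p) :=
  (\col_j \int[mu]_(t in `]0, 1[) (b t j 0 * J_fun tau t)) *t (1%:M : 'M[R]_p).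

End extremile_regression.
Arguments b_tilde {R} p {q} b tau.

(* Main.v *)
Require Import Defs.
From HB Require Import structures.
From mathcomp Require Import all_boot all_order all_algebra.
From mathcomp Require Import all_classical all_reals all_analysis.
From mathcomp Require Import measurable_realfun ring lra.

Import Order.TTheory GRing.Theory Num.Theory.
Import numFieldTopology.Exports numFieldNormedType.Exports.

Local Open Scope classical_set_scope.
Local Open Scope ring_scope.

(* Since Sigma_Z A = E(Z S^T), putting M = A^T Sigma_Z A gives
   E{(S - c A^T Z)(S - c A^T Z)^T} = Sigma + (c^2 - 2 c) M for every c; c = 1 and
   c = 1 / (1 + rho) yield both decompositions, and the difference of the two
   covariances is M / (1 + rho).  Transporting this through the sandwich needs
   H to be symmetric: the score is a subgradient of the loss, and the increments
   of the loss along the sides of a small square at alpha^* force the Jacobian of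
   the score to be symmetric as soon as the score is differentiable there. *)

(** The Archimedean limit that removes the discretization error when a segment is cut into [n.+1]
    pieces. *)
Lemma le_inv_nat_le0 (R : realType) (x c : R) :
  (forall n, x <= c / n.+1%:R) -> x <= 0.
Proof.
move=> xc; rewrite leNgt; apply/negP => x0.
have [n nc] : exists n : nat, c / x < n%:R.
  by exists (Num.truncn (`|c / x|)).+1; apply: le_lt_trans (ler_norm _) (truncnS_gt _).
have := xc n; rewrite ler_pdivlMr// leNgt => /negP; apply.
rewrite -ltr_pdivrMl// mulrC (lt_le_trans nc)// ler_nat//.
Qed.

(** * Increments along a segment recovered from subgradients *)

Section subgradient_edge.
Context {R : realType} (phi psi : R -> R).
Hypothesis sub : forall x h, phi x + h * psi x <= phi (x + h).

(** The subgradient inequality is chained from node [k * h] to the next. Each step gains at least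
    [h * (g + a * k * h - E)], and the indices [k < n] add up to [n * (n - 1) / 2]: a left Riemann
    sum. *)
Lemma subgradient_partition (g a E h : R) (n : nat) : 0 <= h ->
  (forall x, 0 <= x <= n%:R * h -> `|psi x - (g + a * x)| <= E) ->
  phi 0 + (n%:R * h) * (g - E) + a * h ^+ 2 * (n%:R * (n%:R - 1) / 2) <=
    phi (n%:R * h).
Proof.
move=> h0; elim: n => [|n IH] ex; first by rewrite !mul0r mulr0 !addr0.
have {}IH := IH (fun x xn => ltac:(by apply: ex; move: xn => /andP[-> xn];
  rewrite /= (le_trans xn)// ler_wpM2r// ler_nat)).
rewrite (_ : n.+1%:R * h = n%:R * h + h); last by rewrite -natr1; ring.
apply: le_trans (sub _ _).
have /ler_normlP[+ _] : `|psi (n%:R * h) - (g + a * (n%:R * h))| <= E.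
  by apply: ex; rewrite mulr_ge0//= ler_wpM2r// ler_nat.
rewrite opprB lerBlDr -natr1 => hE.
have := ler_wpM2l h0 hE.
nra.
Qed.

(** With [n.+1] steps of length [D / n.+1], the left Riemann sum of [a * x] differs from
    [a * D ^+ 2 / 2] by [a * D ^+ 2 / 2 / n.+1], which vanishes as [n] grows. *)
Lemma subgradient_increment_ge (g a E D : R) : 0 <= D ->
  (forall x, 0 <= x <= D -> `|psi x - (g + a * x)| <= E) ->
  D * g + a * D ^+ 2 / 2 - D * E <= phi D - phi 0.
Proof.
move=> D0 ex; rewrite -subr_le0.
apply: (@le_inv_nat_le0 _ _ (a * D ^+ 2 / 2)) => n.
have n0 : n.+1%:R != 0 :> R by rewrite pnatr_eq0.
have := @subgradient_partition g a E (D / n.+1%:R) n.+1.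
rewrite (mulrC n.+1%:R (D / _)) divfK// => /(_ _ ex).
have -> : a * (D / n.+1%:R) ^+ 2 * (n.+1%:R * (n.+1%:R - 1) / 2) =
   a * D ^+ 2 / 2 - a * D ^+ 2 / 2 / n.+1%:R by field.
by move=> /(_ (divr_ge0 D0 (ler0n _ _))); move: (a * D ^+ 2 / 2 / _) => i; nra.
Qed.

End subgradient_edge.

(** A substitute for the fundamental theorem of calculus. The missing upper bound is the lower bound
    for the reversed function [phi (D - x)], whose subgradient is [- psi (D - x)]. *)
Lemma subgradient_increment (R : realType) (phi psi : R -> R) (g a E D : R) :
  0 <= D -> (forall x h, phi x + h * psi x <= phi (x + h)) ->
  (forall x, 0 <= x <= D -> `|psi x - (g + a * x)| <= E) ->
  `|phi D - phi 0 - (D * g + a * D ^+ 2 / 2)| <= D * E.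
Proof.
move=> D0 sub ex.
have lo := subgradient_increment_ge phi psi sub g a E D D0 ex.
have := @subgradient_increment_ge _ (fun x => phi (D - x)) (fun x => - psi (D - x))
  _ (- (g + a * D)) a E D D0.
rewrite /= subrr subr0 => up.
rewrite ler_norml; apply/andP; split; first by lra.
suff : D * - (g + a * D) + a * D ^+ 2 / 2 - D * E <= phi 0 - phi D by lra.
apply: up.
- move=> x h; rewrite (_ : D - (x + h) = D - x + - h); last by ring.
  by apply: le_trans (sub _ _); lra.
- move=> x /andP[x0 xD]; rewrite (_ : _ - _ = - (psi (D - x) - (g + a * (D - x)))); last by ring.
  by rewrite normrN; apply: ex; apply/andP; split; lra.
Qed.

(* Both two-edge paths from (0, 0) to (D, D) give the increment of F up to
   o(D^2); comparing the D^2 coefficients identifies the mixed derivatives. *)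
Lemma subgradient_cross_derivative (R : realType) (F G1 G2 : R -> R -> R)
    (g1 g2 a11 a12 a21 a22 : R) :
  (forall s t h, F s t + h * G1 s t <= F (s + h) t) ->
  (forall s t h, F s t + h * G2 s t <= F s (t + h)) ->
  (forall e, 0 < e -> exists2 D, 0 < D & forall s t, 0 <= s <= D -> 0 <= t <= D ->
     `|G1 s t - (g1 + (a11 * s + a12 * t))| <= e * D /\
     `|G2 s t - (g2 + (a21 * s + a22 * t))| <= e * D) ->
  a12 = a21.
Proof.
move=> sub1 sub2 ex; apply/eqP; rewrite -subr_eq0 -normr_le0.
apply/ler_addgt0Pr => e e0; rewrite add0r.
(* Each of the four edges costs an error [D * (e / 4 * D)], hence [e * D ^+ 2] in all. *)
have [|D D0 {}ex] := ex (e / 4); first by rewrite divr_gt0.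
have D00 := ltW D0.
have i0 : 0 <= (0 : R) <= D by rewrite lexx.
have iD : 0 <= D <= D by rewrite lexx D00.
have b := @subgradient_increment _ (F ^~ 0) (G1 ^~ 0) g1 a11 (e / 4 * D) D D00
  (fun x h => sub1 x 0 h).
have t := @subgradient_increment _ (F ^~ D) (G1 ^~ D) (g1 + a12 * D) a11
  (e / 4 * D) D D00 (fun x h => sub1 x D h).
have l := @subgradient_increment _ (F 0) (G2 0) g2 a22 (e / 4 * D) D D00
  (fun x h => sub2 0 x h).
have r := @subgradient_increment _ (F D) (G2 D) (g2 + a21 * D) a22
  (e / 4 * D) D D00 (fun x h => sub2 D x h).
have {}b := b (fun x xD => ltac:(have [+ _] := ex x 0 xD i0; by rewrite mulr0 addr0)).
have {}t := t (fun x xD => ltac:(have [+ _] := ex x D xD iD; by rewrite addrA addrAC)).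
have {}l := l (fun x xD => ltac:(have [_ +] := ex 0 x i0 xD; by rewrite mulr0 add0r)).
have {}r := r (fun x xD => ltac:(have [_ +] := ex D x iD xD; by rewrite addrA)).
move: b t l r; rewrite !ler_norml => /andP[b1 b2] /andP[t1 t2] /andP[l1 l2] /andP[r1 r2].
have DD : 0 < D ^+ 2 by rewrite exprn_gt0.
by apply/andP; split; rewrite -(ler_pM2r DD); nra.
Qed.

(** * Symmetry of the Jacobian of the score *)

Section hessian.
Context {R : realType} {p q : nat}.

(** The remainder of the differential is small uniformly in the direction, so one [D] serves the
    whole square. *)
Lemma differentiable_plane_expansion (f : 'M[R]_(p, q) -> R)
    (a u v : 'M[R]_(p, q)) (e : R) : differentiable f a -> 0 < e ->
  \forall D \near 0^'+, forall s t, 0 <= s <= D -> 0 <= t <= D ->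
    `|f (s *: u + (t *: v + a)) - (f a + ('D_u f a * s + 'D_v f a * t))| <= e * D.
Proof.
(* Displacements have norm at most [C * D], so precision [e / C] yields [e * D]; the [+ 1] keeps [C]
   positive when [u] and [v] vanish. *)
move=> fa e0; pose C := `|u| + `|v| + 1.
have C0 : 0 < C by rewrite ltr_wpDl// addr_ge0.
have lo := (eqaddoP _ _ _ _).1 (diff_locally fa) (e / C) (divr_gt0 e0 C0).
have [d /= d0 dP] := (nbhs_normP _ _).1 lo.
near=> D => s t /andP[s0 sD] /andP[t0 tD].
have D0 : 0 < D by near: D; exact: nbhs_right_gt.
have nh : `|s *: u + t *: v| <= C * D.
  rewrite (le_trans (ler_normD _ _))// !normrZ (ger0_norm s0) (ger0_norm t0).
  by have := normr_ge0 u; have := normr_ge0 v; rewrite /C; nra.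
have DC : C * D < d.
  by rewrite mulrC -ltr_pdivlMr//; near: D; apply: nbhs_right_lt; exact: divr_gt0.
have /= := dP (s *: u + t *: v).
rewrite /ball_ /= sub0r normrN => /(_ (le_lt_trans nh DC)).
rewrite !fctE /=.
have -> : 'd f a (s *: u + t *: v) = s * 'D_u f a + t * 'D_v f a.
  by rewrite !deriveE// linearD !linearZ.
rewrite opprD addrA => H.
rewrite addrA (mulrC ('D_u f a)) (mulrC ('D_v f a)) opprD addrA.
by apply: le_trans H _; rewrite mulrAC ler_pdivrMr// -mulrA ler_pM2l// mulrC.
Unshelve. all: by end_near. Qed.

(** Takes the place of Schwarz's theorem: the loss is restricted to the plane through [a] along two
    coordinate directions, with the matching components of the score as subgradients. *)
Lemma jac_vec_score_sym (b : R -> 'cV[R]_q)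
    (ib : forall j, (@lebesgue_measure R).-integrable `]0, 1[
                      (fun t => (b t j 0)%:E))
    (y : R) (x : 'cV[R]_p) (a : 'M[R]_(p, q)) :
  differentiable (score b y x) a ->
  (jac_vec (score b y x) a)^T = jac_vec (score b y x) a.
Proof.
move=> da; apply/matrixP => l k; rewrite !mxE.
set f := score b y x in da *.
have dc i : differentiable (fun a => f a i 0) a.
  apply: (@differentiable_comp _ _ _ _ f (fun v => v i 0)) => //.
  exact: differentiable_coord.
pose pt s t := s *: vec_dir k + (t *: vec_dir l + a).
(* The goal supplies the mixed coefficients: component [k] differentiated along [l], and component
   [l] along [k]. *)
apply: (@subgradient_cross_derivative _ (fun s t => loss b y x (pt s t))
  (fun s t => f (pt s t) k 0) (fun s t => f (pt s t) l 0) (f a k 0) (f a l 0)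
  ('D_(vec_dir k) (fun a => f a k 0) a) _ _
  ('D_(vec_dir l) (fun a => f a l 0) a)).
- move=> s t h; have := score_subgradient ib y x (pt s t) k h.
  by rewrite /pt (addrC s h) scalerDl -!addrA.
- move=> s t h; rewrite (_ : pt s (t + h) = h *: vec_dir l + pt s t).
    exact: score_subgradient.
  by rewrite /pt scalerDl -addrA [RHS]addrCA; congr (_ + _); exact: addrCA.
- move=> e e0.
  have Hk := @differentiable_plane_expansion _ a (vec_dir k) (vec_dir l) e (dc k) e0.
  have Hl := @differentiable_plane_expansion _ a (vec_dir k) (vec_dir l) e (dc l) e0.
  have [D [D0 [Dk Dl]]] := filter_ex (filterI (nbhs_right_gt 0) (filterI Hk Hl)).
  by exists D => // s t s0 t0; split; [exact: Dk|exact: Dl].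
Qed.

End hessian.
(* The suprema over Theta and the Jacobian of the score are not known to be
   measurable, hence these versions without measurability hypotheses. *)
Section integral_nonmeasurable.
Local Open Scope ereal_scope.
Context {d : measure_display} {T : measurableType d} {R : realType}
  (mu : {measure set T -> \bar R}).
Implicit Types f g : T -> \bar R.
Import HBNNSimple.

(** The integral is a supremum over simple functions lying below, and a larger function has more of
    them. *)
Lemma ge0_le_integralT f g : (forall x, 0 <= f x) -> (forall x, f x <= g x) ->
  \int[mu]_x f x <= \int[mu]_x g x.
Proof.
move=> f0 fg; rewrite !ge0_integralTE//; last by move=> x; exact: le_trans (fg x).
apply: le_ereal_sup => _ [h hf <-]; exists h => // x; exact: le_trans (fg x).
Qed.

Lemma ge0_ae_le_integralT f g : (forall x, 0 <= f x) -> (forall x, 0 <= g x) ->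
  {ae mu, forall x, f x <= g x} -> \int[mu]_x f x <= \int[mu]_x g x.
Proof.
move=> f0 g0 [N [mN muN fgN]]; rewrite [leLHS]ge0_integralTE//.
apply: ge_ereal_sup => _ [h hf <-].
(* The simple function [h] is measurable even if [f] is not, so the null set [N] can be cut out of
   its integral; off [N] it lies below [g]. *)
rewrite -integralT_nnsfun (@ge0_negligible_integral _ _ _ _ _ N)//; last 2 first.
- by apply/measurable_EFinP.
- by move=> x _; rewrite lee_fin.
rewrite integral_mkcond; apply: ge0_le_integralT.
- by apply: erestrict_ge0 => x _; rewrite lee_fin.
- move=> x; rewrite patchE; case: ifPn => // /set_mem [_ Nx].
  rewrite (le_trans (hf x))//; apply: contrapT => fg; exact/Nx/fgN.
Qed.

Lemma ae_eq_integralT f g : {ae mu, forall x, f x = g x} ->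
  \int[mu]_x f x = \int[mu]_x g x.
Proof.
move=> fg; rewrite integralE [RHS]integralE; congr (_ - _); apply/eqP;
  rewrite eq_le; apply/andP; split; apply: ge0_ae_le_integralT => //;
  by apply: filterS fg => x; rewrite !(funeposE, funenegE) => ->.
Qed.

End integral_nonmeasurable.

(** * Square integrability and measurability of the score *)

Section L2.
Context {d : measure_display} {T : measurableType d} {R : realType}
  (P : {measure set T -> \bar R}).

Definition square_integrable (f : T -> R) : Prop :=
  measurable_fun setT f /\ (\int[P]_w ((f w) ^+ 2)%:E < +oo)%E.

(** The product is dominated by [f ^+ 2 + g ^+ 2]. *)
Lemma square_integrableM (f g : T -> R) :
  square_integrable f -> square_integrable g ->
  P.-integrable setT (fun w => (f w * g w)%:E).
Proof.
have sq h : square_integrable h -> P.-integrable setT (fun w => ((h w) ^+ 2)%:E).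
  move=> [mh h2]; apply/integrableP; split.
    by apply/measurable_EFinP; exact: measurable_funX.
  by under eq_integral do rewrite gee0_abs ?lee_fin ?sqr_ge0//.
move=> f2 g2; have := integrableD measurableT (sq _ f2) (sq _ g2).
apply: le_integrable => //.
  by apply/measurable_EFinP; apply: measurable_funM; [case: f2|case: g2].
move=> w _; rewrite /= lee_fin (ger0_norm (addr_ge0 (sqr_ge0 _) (sqr_ge0 _))).
by rewrite ler_norml; apply/andP; split; nra.
Qed.

End L2.

Section measurable_score.
Context {disp : measure_display} {T : measurableType disp} {R : realType}
  {p q : nat} (Y : T -> R) (X : T -> 'cV[R]_p) (b : R -> 'cV[R]_q).
Local Notation mu := (@lebesgue_measure R).
Hypothesis mY : measurable_fun setT Y.
Hypothesis mX : forall i, measurable_fun setT (fun w => X w i 0).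
Hypothesis mb : forall j, measurable_fun (`]0, 1[ : set R) (fun t => b t j 0).

(** Once [b] is extended by 0 outside the unit interval, the integrand is jointly measurable in
    [(w, t)]; Tonelli applies to its positive and negative parts separately. *)
Lemma measurable_score (a : 'M[R]_(p, q)) k :
  measurable_fun setT (fun w => score b (Y w) (X w) a k 0).
Proof.
pose B j := (fun t => b t j 0) \_ (`]0, 1[ : set R).
have mB j : measurable_fun setT (B j) by apply/(measurable_restrictT _ _).1.
pose lin (z : T * R) := \sum_(j < q) (\sum_(i < p) X z.1 i 0 * a i j) * B j z.2.
pose f (z : T * R) := B (mxtens_unindex k).1 z.2 * X z.1 (mxtens_unindex k).2 0 *
  ((if Y z.1 < lin z then 1 else 0) - z.2).
have m1 (h : T -> R) : measurable_fun setT h -> measurable_fun setT (fun z : T * R => h z.1).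
  by move=> mh; exact: measurableT_comp.
have m2 (h : R -> R) : measurable_fun setT h -> measurable_fun setT (fun z : T * R => h z.2).
  by move=> mh; exact: measurableT_comp.
have mlin : measurable_fun setT lin.
  apply: measurable_sum => j; apply: measurable_funM; last exact: m2.
  by apply: (m1 (fun w => \sum_(i < p) X w i 0 * a i j));
    apply: measurable_sum => i; exact: measurable_funM.
have mf : measurable_fun setT (EFin \o f).
  apply/measurable_EFinP; apply: measurable_funM.
    by apply: measurable_funM; [exact: m2|exact: (m1 (fun w => X w (mxtens_unindex k).2 0))].
  apply: measurable_funB; last exact: (m2 id).
  apply: measurable_fun_if => //; apply: measurable_fun_ltr => //; exact: (m1 Y).
rewrite (_ : (fun _ => _) = fine \o (fun w => \int[mu]_t (EFin \o f) (w, t))%E); last first.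
  apply/funext => w; rewrite mxE /Rintegral/= integral_mkcond; congr fine.
  apply: eq_integral => t _; rewrite patchE /f /B patchE; case: ifPn => // t01; last by rewrite !mul0r.
    rewrite kronE kron_vec; congr (_ * (_ - _))%:E.
    rewrite (_ : lin _ = (((X w)^T *m a) *m b t) 0 0); first by case: ifP.
    rewrite /lin !mxE; apply: eq_bigr => j _; rewrite /B patchE t01 mxE.
    by congr (_ * _); apply: eq_bigr => i _; rewrite mxE.
apply: measurableT_comp => //.
rewrite (_ : (fun _ => _) = (fun w => \int[mu]_t ((EFin \o f)^\+ (w, t)) -
                             \int[mu]_t ((EFin \o f)^\- (w, t)))%E); last first.
  apply/funext => w; rewrite integralE.
  by congr (_ - _)%E; apply: eq_integral => t _; rewrite !(funeposE, funenegE).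
apply: emeasurable_funB.
- by apply: (@measurable_fun_fubini_tonelli_F _ _ _ _ _ mu (EFin \o f)^\+%E) => //;
    exact: measurable_funepos.
- by apply: (@measurable_fun_fubini_tonelli_F _ _ _ _ _ mu (EFin \o f)^\-%E) => //;
    exact: measurable_funeneg.
Qed.

End measurable_score.

(** * Expectations of random matrices and second moments of residuals *)

Section expectation_mx.
Context {disp : measure_display} {T : measurableType disp} {R : realType}
  (P : probability T R).

Definition integrable_mx {m n : nat} (M : T -> 'M[R]_(m, n)) : Prop :=
  forall i j, P.-integrable setT (fun w => (M w i j)%:E).

Lemma EmxE {m n} (M : T -> 'M[R]_(m, n)) i j :
  Emx P M i j = \int[P]_w (M w i j).
Proof. by rewrite mxE unlock. Qed.

Lemma Emx_tr {m n} (M : T -> 'M[R]_(m, n)) :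
  Emx P (fun w => (M w)^T) = (Emx P M)^T.
Proof.
by apply/matrixP => i j; rewrite [RHS]mxE !EmxE; apply: eq_Rintegral => w _; rewrite mxE.
Qed.

Lemma integrable_mx_tr {m n} (M : T -> 'M[R]_(m, n)) :
  integrable_mx M -> integrable_mx (fun w => (M w)^T).
Proof. by move=> iM i j; under eq_fun do rewrite mxE; exact: iM. Qed.

Lemma integrable_mxD {m n} (M N : T -> 'M[R]_(m, n)) :
  integrable_mx M -> integrable_mx N -> integrable_mx (fun w => M w + N w).
Proof.
move=> iM iN i j; under eq_fun do rewrite mxE EFinD.
exact: integrableD (iM i j) (iN i j).
Qed.

Lemma EmxD {m n} (M N : T -> 'M[R]_(m, n)) :
  integrable_mx M -> integrable_mx N ->
  Emx P (fun w => M w + N w) = Emx P M + Emx P N.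
Proof.
move=> iM iN; apply/matrixP => i j; rewrite [RHS]mxE !EmxE.
rewrite -RintegralD//; [|exact: iM|exact: iN].
by apply: eq_Rintegral => w _; rewrite mxE.
Qed.

Lemma integrable_mulmxl {k m n} (B : 'M[R]_(k, m)) (M : T -> 'M[R]_(m, n)) :
  integrable_mx M -> integrable_mx (fun w => B *m M w).
Proof.
move=> iM i j; under eq_fun do rewrite mxE -sumEFin.
apply: integrable_sum => // l _; exact: (integrableZl _ (B i l) (iM l j)).
Qed.

Lemma Emx_mulmxl {k m n} (B : 'M[R]_(k, m)) (M : T -> 'M[R]_(m, n)) :
  integrable_mx M -> Emx P (fun w => B *m M w) = B *m Emx P M.
Proof.
move=> iM; apply/matrixP => i j.
have iBM l : P.-integrable setT (fun w => (B i l * M w l j)%:E).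
  exact: (integrableZl _ (B i l) (iM l j)).
rewrite EmxE mxE /Rintegral.
under eq_integral do rewrite mxE -sumEFin.
rewrite integral_sum//.
rewrite -sum_fine; last first.
  by move=> l _; exact: integrable_fin_num.
apply: eq_bigr => l _; rewrite EmxE -RintegralZl//; exact: iM.
Qed.

Lemma integrable_mulmxr {k m n} (M : T -> 'M[R]_(m, n)) (B : 'M[R]_(n, k)) :
  integrable_mx M -> integrable_mx (fun w => M w *m B).
Proof.
move=> /integrable_mx_tr/(integrable_mulmxl B^T)/integrable_mx_tr iM i j.
by under eq_fun do rewrite -(trmxK (_ *m B)) trmx_mul.
Qed.

Lemma Emx_mulmxr {k m n} (M : T -> 'M[R]_(m, n)) (B : 'M[R]_(n, k)) :
  integrable_mx M -> Emx P (fun w => M w *m B) = Emx P M *m B.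
Proof.
move=> /integrable_mx_tr iM; rewrite -[RHS]trmxK trmx_mul -!Emx_tr -Emx_mulmxl//.
by rewrite -Emx_tr; congr (Emx P _); apply/funext => w; rewrite trmx_mul !trmxK.
Qed.

(** The quadratic form is the expectation of the square of the scalar [v^T *m x w]. *)
Lemma Emx_outer_ge0 {n} (x : T -> 'cV[R]_n) (v : 'cV[R]_n) :
  integrable_mx (fun w => x w *m (x w)^T) ->
  0 <= (v^T *m Emx P (fun w => x w *m (x w)^T) *m v) 0 0.
Proof.
move=> ix; rewrite -Emx_mulmxl// -Emx_mulmxr; last exact: integrable_mulmxl.
rewrite EmxE; apply: Rintegral_ge0 => w _.
have -> : v^T *m (x w *m (x w)^T) *m v = (v^T *m x w) *m (v^T *m x w)^T.
  by rewrite trmx_mul trmxK !mulmxA.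
by rewrite mxE big_ord1 [X in _ * X]mxE -expr2 sqr_ge0.
Qed.

Lemma Emx_outer_mulmx {m n} (B : 'M[R]_(m, n)) (x : T -> 'cV[R]_n) :
  integrable_mx (fun w => x w *m (x w)^T) ->
  Emx P (fun w => (B *m x w) *m (B *m x w)^T) =
  B *m Emx P (fun w => x w *m (x w)^T) *m B^T.
Proof.
move=> ix; rewrite -Emx_mulmxl// -Emx_mulmxr; last exact: integrable_mulmxl.
by congr (Emx P _); apply/funext => w; rewrite trmx_mul !mulmxA.
Qed.

Lemma integrable_mx_outer {m n} (x : T -> 'cV[R]_m) (y : T -> 'cV[R]_n) :
  (forall i, square_integrable P (fun w => x w i 0)) ->
  (forall j, square_integrable P (fun w => y w j 0)) ->
  integrable_mx (fun w => x w *m (y w)^T).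
Proof.
move=> x2 y2 i j; under eq_fun do rewrite mxE big_ord1 [X in _ * X]mxE.
exact: square_integrableM.
Qed.

(** Meant for the Jacobian of the score, whose symmetry is only known almost surely. *)
Lemma ae_eq_Emx {m n} (M N : T -> 'M[R]_(m, n)) :
  {ae P, forall w, M w = N w} -> Emx P M = Emx P N.
Proof.
move=> MN; apply/matrixP => i j; rewrite !EmxE; congr fine.
by apply: ae_eq_integralT; apply: filterS MN => w ->.
Qed.

Lemma Emx_outer_residual {m n} (S : T -> 'cV[R]_m) (Z : T -> 'cV[R]_n)
    (D : 'M[R]_(n, m)) :
  integrable_mx (fun w => S w *m (S w)^T) ->
  integrable_mx (fun w => Z w *m (S w)^T) ->
  integrable_mx (fun w => Z w *m (Z w)^T) ->
  Emx P (fun w => (S w - D^T *m Z w) *m (S w - D^T *m Z w)^T) =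
  Emx P (fun w => S w *m (S w)^T) - D^T *m Emx P (fun w => Z w *m (S w)^T)
  - (Emx P (fun w => Z w *m (S w)^T))^T *m D
  + D^T *m Emx P (fun w => Z w *m (Z w)^T) *m D.
Proof.
move=> iSS iZS iZZ.
have iSZ := integrable_mx_tr _ iZS.
rewrite -Emx_tr -(mulNmx D^T) -(mulmxN _ D).
rewrite -Emx_mulmxl// -!Emx_mulmxl// -!Emx_mulmxr//; last exact: integrable_mulmxl.
have i1 : integrable_mx (fun w => - D^T *m (Z w *m (S w)^T)) by exact: integrable_mulmxl.
have i2 : integrable_mx (fun w => (Z w *m (S w)^T)^T *m - D) by exact: integrable_mulmxr.
have i3 : integrable_mx (fun w => D^T *m (Z w *m (Z w)^T) *m D).
  by apply: integrable_mulmxr; exact: integrable_mulmxl.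
have i4 := integrable_mxD _ _ iSS i1.
rewrite -!EmxD//; last exact: (integrable_mxD _ _ i4 i2).
congr (Emx P _); apply/funext => w.
rewrite linearB /= !trmx_mul !trmxK mulmxBl !mulmxBr mulNmx mulmxN !mulmxA.
by rewrite opprB addrA addrAC; congr (_ + _); exact: addrAC.
Qed.

(** The normal equation satisfied by [A] turns one cross term into [M]; symmetry of the second
    moment of [Z] does the same for its transpose. *)
Lemma Emx_outer_shrunk_projection {m n} (S : T -> 'cV[R]_m) (Z : T -> 'cV[R]_n)
    (c : R) :
  integrable_mx (fun w => S w *m (S w)^T) ->
  integrable_mx (fun w => Z w *m (S w)^T) ->
  integrable_mx (fun w => Z w *m (Z w)^T) ->
  Emx P (fun w => Z w *m (Z w)^T) \in unitmx ->
  let A := invmx (Emx P (fun w => Z w *m (Z w)^T)) *m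
           Emx P (fun w => Z w *m (S w)^T) in
  let M := A^T *m Emx P (fun w => Z w *m (Z w)^T) *m A in
  Emx P (fun w => (S w - c *: (A^T *m Z w)) *m (S w - c *: (A^T *m Z w))^T) =
  Emx P (fun w => S w *m (S w)^T) + (c ^+ 2 - 2 * c) *: M.
Proof.
move=> iSS iZS iZZ uZ A M.
have symZ : (Emx P (fun w => Z w *m (Z w)^T))^T = Emx P (fun w => Z w *m (Z w)^T).
  by rewrite -Emx_tr; congr (Emx P _); apply/funext => w; rewrite trmx_mul trmxK.
have AC : A^T *m Emx P (fun w => Z w *m (S w)^T) = M.
  by rewrite /M -mulmxA /A mulKVmx.
have CA : (Emx P (fun w => Z w *m (S w)^T))^T *m A = M.
  by rewrite -AC /A trmx_mul trmx_inv symZ !mulmxA.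
have := Emx_outer_residual S Z (c *: A) iSS iZS iZZ.
under [X in Emx _ X = _]eq_fun do rewrite linearZ /= -scalemxAl.
move=> ->; rewrite linearZ /= -!scalemxAl -!scalemxAr CA AC -/M.
have -> : c ^+ 2 - 2 * c = - c + (- c + c * c) by ring.
by rewrite -!scaleNr scalerA -!addrA 2!(scalerDl M).
Qed.

End expectation_mx.

Lemma loewner_le_congr (R : realType) (m n : nat) (A B : 'M[R]_n)
    (D : 'M[R]_(n, m)) :
  loewner_le A B -> loewner_le (D^T *m A *m D) (D^T *m B *m D).
Proof.
move=> [sAB pAB]; rewrite /loewner_le -mulmxBl -mulmxBr; split.
  by rewrite !trmx_mul trmxK sAB mulmxA.
by move=> v; rewrite !mulmxA -trmx_mul -mulmxA; exact: pAB.
Qed.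

Lemma sqr_entry_le_l2norm (R : realType) (n : nat) (v : 'cV[R]_n) i :
  v i 0 ^+ 2 <= l2norm v ^+ 2.
Proof.
rewrite sqr_sqrtr; last by apply: sumr_ge0 => j _; exact: sqr_ge0.
by rewrite (bigD1 i)//= lerDl; apply: sumr_ge0 => j _; exact: sqr_ge0.
Qed.

(** * The decompositions and the comparison of asymptotic covariances *)

Theorem mainTheorem6 (R : realType) (disp : measure_display)
  (T : measurableType disp) (P : probability T R) (p q d : nat)
  (Y : T -> R) (X : T -> 'cV[R]_p) (b : R -> 'cV[R]_q)
  (g : 'cV[R]_p -> 'cV[R]_d.+1)
  (Theta : set 'M[R]_(p, q)) (alpha_star : 'M[R]_(p, q)) (rho : R)
  (mY : measurable_fun setT Y)
  (mX : forall i, measurable_fun setT (fun w => X w i 0))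
  (mZ : forall i, measurable_fun setT (fun w => g (X w) i 0))
  (ib : forall j, (@lebesgue_measure R).-integrable `]0, 1[
                    (fun t => (b t j 0)%:E))
  (Z_first : forall x, g x 0 0 = 1)
  (rho_ge0 : 0 <= rho)
  (alpha_star_argmin : Theta alpha_star /\
     forall alpha, Theta alpha ->
       ('E_P[fun w => loss b (Y w) (X w) alpha_star] <=
        'E_P[fun w => loss b (Y w) (X w) alpha])%E)
  (C2_loss : (\int[P]_w ereal_sup
     [set (loss b (Y w) (X w) alpha ^+ 2)%:E | alpha in Theta] < +oo)%E)
  (C2_C1 : {ae P, forall w,
     continuously_differentiable_on Theta (score b (Y w) (X w))})
  (C2_score : (\int[P]_w ereal_sup
     [set (l2norm (score b (Y w) (X w) alpha) ^+ 2)%:E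
        | alpha in Theta] < +oo)%E)
  (C2_hess : (\int[P]_w ereal_sup
     [set (spectral_norm (jac_vec (score b (Y w) (X w)) alpha))%:E
        | alpha in Theta] < +oo)%E)
  (C4_compact : compact Theta)
  (C4_interior : (Theta°)%classic alpha_star)
  (C4_H : Emx P (fun w => jac_vec (score b (Y w) (X w)) alpha_star)
            \in unitmx)
  (C5_bounded : exists M : R, {ae P, forall w, l2norm (g (X w)) <= M})
  (C5_Sigma : Emx P (fun w => g (X w) *m (g (X w))^T) \in unitmx) :
  let S := fun w => score b (Y w) (X w) alpha_star in
  let Z := fun w => g (X w) in
  let H := Emx P (fun w => jac_vec (score b (Y w) (X w)) alpha_star) in
  let SigmaZ := Emx P (fun w => Z w *m (Z w)^T) in
  let A := invmx SigmaZ *m Emx P (fun w => Z w *m (S w)^T) in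
  let U := fun w => S w - A^T *m Z w in
  let W := fun w => S w - (1 / (1 + rho)) *: (A^T *m Z w) in
  let V := fun w => (1 / (1 + rho)) *: (A^T *m Z w) in
  let Sigma := Emx P (fun w => S w *m (S w)^T) in
  let Sigma_rho := Emx P (fun w => W w *m (W w)^T)
                   + rho *: Emx P (fun w => V w *m (V w)^T) in
  let EUU := Emx P (fun w => U w *m (U w)^T) in
  let EAZ := Emx P (fun w => (A^T *m Z w) *m (A^T *m Z w)^T) in
  [/\ Sigma = EUU + EAZ,
      Sigma_rho = EUU + (rho / (1 + rho)) *: EAZ,
      loewner_le Sigma_rho Sigma &
      forall tau : R, 0 < tau < 1 ->
        let bt := b_tilde p b tau in
        loewner_le (bt^T *m invmx H *m Sigma_rho *m invmx H *m bt)
                   (bt^T *m invmx H *m Sigma *m invmx H *m bt)].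
Proof.
move=> S Z H SigmaZ A U W V Sigma Sigma_rho EUU EAZ.
(* The squared norm of the score at [alpha_star] is one member of the supremum in [C2_score]. *)
have S2 k : square_integrable P (fun w => S w k 0).
  split.
    apply: measurable_score => // j; apply/measurable_EFinP.
    exact: measurable_int (ib j).
  apply: le_lt_trans C2_score; apply: ge0_le_integralT => w.
    by rewrite lee_fin sqr_ge0.
  apply: (@le_trans _ _ (l2norm (S w) ^+ 2)%:E).
    by rewrite lee_fin sqr_entry_le_l2norm.
  by apply: ereal_sup_ubound; exists alpha_star => //; case: alpha_star_argmin.
have Z2 i : square_integrable P (fun w => Z w i 0).
  split; first exact: mZ.
  have [M ZM] := C5_bounded.
  apply: (@le_lt_trans _ _ (\int[P]_w (M ^+ 2)%:E)%E).
    apply: ge0_ae_le_integralT => [w|w|]; rewrite ?lee_fin ?sqr_ge0//.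
    apply: filterS ZM => w wM; rewrite lee_fin.
    apply: le_trans (sqr_entry_le_l2norm _ _ _ i) _.
    by rewrite lerXn2r// nnegrE ?(le_trans _ wM)// sqrtr_ge0.
  by rewrite integral_cst//= probability_setT mule1 ltry.
have iSS := integrable_mx_outer P S S S2 S2.
have iZS := integrable_mx_outer P Z S Z2 S2.
have iZZ := integrable_mx_outer P Z Z Z2 Z2.
(* Almost surely the score is differentiable on [Theta], in particular at [alpha_star]. *)
have symH : H^T = H.
  rewrite -Emx_tr; apply: ae_eq_Emx; apply: filterS C2_C1 => w [dS _].
  by apply: jac_vec_score_sym => //; apply: dS; case: alpha_star_argmin.
have EAZE : EAZ = A^T *m SigmaZ *m A by rewrite /EAZ Emx_outer_mulmx// trmxK.
have rho1 : 1 + rho != 0 by rewrite gt_eqF// ltr_pwDl.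
have residE c : Emx P (fun w => (S w - c *: (A^T *m Z w)) *m
    (S w - c *: (A^T *m Z w))^T) = Sigma + (c ^+ 2 - 2 * c) *: EAZ.
  rewrite EAZE; exact: (Emx_outer_shrunk_projection P S Z c iSS iZS iZZ C5_Sigma).
have EUUE : EUU = Sigma - EAZ.
  have := residE 1.
  under [X in Emx _ X = _]eq_fun do rewrite scale1r.
  rewrite /EUU /U => ->; rewrite -(scaleN1r EAZ); congr (_ + _ *: _); ring.
(* With [c = 1 / (1 + rho)], the coefficient of [EAZ] is [c ^+ 2 - 2 * c + rho * c ^+ 2], that is
   [- c]. *)
have Sigma_rhoE : Sigma_rho = Sigma - (1 / (1 + rho)) *: EAZ.
  rewrite /Sigma_rho residE.
  rewrite (_ : Emx P (fun w => V w *m (V w)^T) = (1 / (1 + rho)) ^+ 2 *: EAZ).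
    rewrite scalerA -addrA -(scalerDl EAZ) -[in RHS]scaleNr; congr (_ + _ *: _).
    by field.
  rewrite /V; under eq_fun do rewrite scalemxAl.
  rewrite Emx_outer_mulmx// linearZ /= trmxK -!scalemxAl -scalemxAr scalerA.
  by rewrite EAZE expr2.
have le_Sigma : loewner_le Sigma_rho Sigma.
  rewrite Sigma_rhoE /loewner_le subKr; split.
    rewrite linearZ /= -Emx_tr; congr (_ *: Emx P _).
    by apply/funext => w; rewrite trmx_mul trmxK.
  (* Up to the factor [1 / (1 + rho)], this is the form of [SigmaZ] at [A *m v]. *)
  move=> v; rewrite -scalemxAr -scalemxAl mxE mulr_ge0 ?divr_ge0 ?addr_ge0//.
  rewrite EAZE; have := Emx_outer_ge0 P Z (A *m v) iZZ.
  by rewrite trmx_mul !mulmxA.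
split => //.
- by rewrite EUUE subrK.
- rewrite Sigma_rhoE EUUE -addrA; congr (_ + _).
  rewrite -(scaleN1r EAZ) -[in LHS]scaleNr -(scalerDl EAZ); congr (_ *: _).
  by field.
(* By symmetry of [H], the transpose of [invmx H *m bt] is [bt^T *m invmx H], so the sandwich is a
   congruence. *)
- move=> tau _ bt; have := loewner_le_congr R _ _ _ _ (invmx H *m bt) le_Sigma.
  by rewrite trmx_mul trmx_inv symH !mulmxA.
Qed.
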